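(* Let $N,K\ge 1$ be integers. There is a constant $C>0$, depending only on $N$ and $K$, such that the following holds. Let $A,B\in\mathbb{C}[z]$ with $\deg A=N$ and $\deg B=K$ satisfy $\|A\|\le 1$ and $\|B\|\le 1$. If $\delta=\delta(A,B)>0$, then the unique minimal solutions $R\in\mathbb{C}_{K-1}[z]$ and $S\in\mathbb{C}_{N-1}[z]$ of Bézout's identity $$A(z)R(z)+B(z)S(z)=1\quad\text{for all } z\in\mathbb{C}$$ satisfy $$\|R\|\le\frac{C}{\delta^2}\quad\text{and}\quad\|S\|\le\frac{C}{\delta^2}.$$
   Context: $\mathbb{C}[z]$ is the space of complex polynomials in one variable and $\mathbb{C}_n[z]$ is the subspace of polynomials of degree at most $n$. For $P(z)=p_0+p_1z+\cdots+p_nz^n$, $\|P\|:=\max_{0\le i\le n}|p_i|$ (maximum modulus of the coefficients). For nonconstant polynomials $A,B$, $$\delta(A,B):=\min\{|A(z)|+|B(z)| : A(z)=0\text{ or }B(z)=0\}.$$ Equivalently, $\delta(A,B)$ is the minimum of all the numbers $|A(\beta)|$ with $B(\beta)=0$ and $|B(\alpha)|$ with $A(\alpha)=0$. If $A,B$ are nonconstant of degrees $N,K$ with no common zeros (i.e. $\delta(A,B)>0$), there is exactly one pair $(R,S)$ with $\deg R\le K-1$, $\deg S\le N-1$ and $AR+BS=1$; these are called the minimal solutions. *)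

(* Defs.v *)
From HB Require Import structures.
From mathcomp Require Import all_boot all_order all_algebra.
From mathcomp Require Import boolp classical_sets reals.
From mathcomp Require Export complex.
Set Implicit Arguments.
Unset Strict Implicit.
Unset Printing Implicit Defensive.
Import Order.TTheory GRing.Theory Num.Theory.
Import ComplexField.Normc.
Local Open Scope ring_scope.
Local Open Scope classical_set_scope.

(* The real-valued modulus [normc] is used rather than [`|z|], whose value
   lives in [R[i]]. *)
Definition coef_norm (R : realType) (P : {poly R[i]}) : R :=
  \big[Num.max/0]_(i < size P) normc P`_i.

Definition zero_values (R : realType) (A B : {poly R[i]}) : set R :=
  [set normc A.[z] + normc B.[z] | z in [set z | A.[z] = 0 \/ B.[z] = 0]].

(* For nonconstant [A] and [B] the infimum is attained: see [delta_min]. *)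
Definition delta (R : realType) (A B : {poly R[i]}) : R :=
  inf (zero_values A B).

Definition minimal_solution (R : realType) (N K : nat) (A B : {poly R[i]})
    (P Q : {poly R[i]}) : Prop :=
  [/\ (size P <= K)%N, (size Q <= N)%N &
      forall z : R[i], A.[z] * P.[z] + B.[z] * Q.[z] = 1].

Lemma delta_min (R : realType) (A B : {poly R[i]}) :
    (1 < size A)%N -> (1 < size B)%N ->
  zero_values A B (delta A B) /\
  (forall x, zero_values A B x -> delta A B <= x).
Proof.
move=> sA sB.
have A0 : A != 0 by rewrite -size_poly_gt0 (ltn_trans _ sA).
have B0 : B != 0 by rewrite -size_poly_gt0 (ltn_trans _ sB).
have AB0 : A * B != 0 by rewrite mulf_neq0.
have [r rE] := closed_field_poly_normal (A * B).
pose f z : R := normc A.[z] + normc B.[z].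
have rP z : (z \in r) <-> (A.[z] = 0 \/ B.[z] = 0).
  rewrite -root_prod_XsubC -(@rootZ _ _ (lead_coef (A * B))) ?lead_coef_eq0 //.
  rewrite -rE rootM; split.
    by case/orP => /rootP; [left|right].
  by case=> /rootP ->; rewrite ?orbT.
have [z0 z0r] : exists z0, z0 \in r.
  have /closed_rootP[z /rootP Az] : size A != 1 by rewrite gtn_eqF.
  by exists z; apply/rP; left.
have [m mr mmin] : exists2 m, m \in r & forall z, z \in r -> f m <= f z.
  elim: (r) z0 z0r {rE rP} => // a s IH _ _.
  case: s IH => [_|b s IH].
    by exists a; rewrite ?mem_head // => z; rewrite inE => /eqP ->.
  have [m ms mmin] := IH b (mem_head _ _).
  have [le|/ltW le] := leP (f a) (f m).
    exists a; rewrite ?mem_head // => z; rewrite inE => /orP[/eqP -> //|zs].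
    exact: le_trans le (mmin z zs).
  exists m; first by rewrite inE ms orbT.
  by move=> z; rewrite inE => /orP[/eqP -> //|]; apply: mmin.
have zm : zero_values A B (f m) by exists m => //; apply/rP.
have lbm : lbound (zero_values A B) (f m).
  by move=> _ [z /= /rP zr <-]; apply: mmin.
suff -> : delta A B = f m by split.
apply/eqP; rewrite eq_le; apply/andP; split.
  by apply: ge_inf => //; exists (f m).
by apply: lb_le_inf => //; exists (f m).
Qed.

(* Main.v *)
(* Write [A = a * \prod_i ('X - al i)] and [B = b * \prod_j ('X - be j)].  Newton
   interpolation of [1 / A] at the zeros of [B] gives the minimal solution [P];
   by the Leibniz rule its Newton coefficients are sums, over monotone lattice
   paths in the grid of cells [(i, j)], of the products of [1 / (al i - be j)]
   along the path.  Each path product is compared with the product of a row,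
   which is [A] at a zero of [B], and a column, which is [B] at a zero of [A];
   this costs one factor [1 / delta] each.  For the comparison all the zeros,
   preceded by [0], are put in the order of Prim's algorithm, so that
   [|x a - x b|] and [|x b - x c|] are at most a constant times [|x a - x c|]
   when [a <= b <= c], the [be j] being listed in that order and the [al i] in
   the reverse one; row and column are those of the cell of the path where
   [|al i - be j|] is least.  The size of the Newton basis polynomials is
   absorbed by the Mahler measure of [B]. *)
Require Import Defs.
From mathcomp Require Import all_boot all_order all_algebra.
From mathcomp Require Import reals complex.
From mathcomp Require Import ring lra zify.
Import Order.TTheory GRing.Theory Num.Theory.
Import ComplexField.Normc.
Local Open Scope ring_scope.

(** * Elementary facts on the modulus *)

Section Modulus.
Context {R : realType}.
Implicit Types x y z : R[i].

Lemma normc_ge0 x : 0 <= normc x.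
Proof. by case: x => a b; apply: sqrtr_ge0. Qed.

Lemma normcD_le x y : normc (x + y) <= normc x + normc y.
Proof. exact: le_normcD. Qed.

Lemma normc_opp x : normc (- x) = normc x.
Proof. exact: normcN. Qed.

Lemma normc_distC x y : normc (x - y) = normc (y - x).
Proof. by rewrite -normc_opp opprB. Qed.

Lemma normc_gt0 x : x != 0 -> 0 < normc x.
Proof.
move=> x0; rewrite lt_neqAle normc_ge0 andbT eq_sym.
by apply: contra x0 => /eqP/eq0_normc ->.
Qed.

Lemma normc_prod (I : Type) (r : seq I) (P : pred I) (f : I -> R[i]) :
  normc (\prod_(i <- r | P i) f i) = \prod_(i <- r | P i) normc (f i).
Proof. by apply: (big_morph _ (@normcM R)); apply: normc1. Qed.

Lemma normc_triangle x y z : normc (x - z) <= normc (x - y) + normc (y - z).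
Proof. by rewrite -[x - z](subrKA y) normcD_le. Qed.

End Modulus.

(** * Monotone lattice paths and products along them *)

Section LatticePaths.

(* The list holds the cells strictly before the end point, last cell first. *)
Inductive lattice_path : nat -> nat -> seq (nat * nat) -> Prop :=
| lattice_path0 : lattice_path 0%N 0%N [::]
| lattice_pathl n k s : lattice_path n k s -> lattice_path n.+1 k ((n, k) :: s)
| lattice_pathr n k s : lattice_path n k s -> lattice_path n k.+1 ((n, k) :: s).

Lemma lattice_path_le n k s c :
  lattice_path n k s -> c \in (n, k) :: s -> (c.1 <= n)%N && (c.2 <= k)%N.
Proof.
move=> h; elim: h c => [|{}n {}k {}s _ IH|{}n {}k {}s _ IH] c.
- by rewrite inE => /eqP ->.
- by rewrite inE => /orP[/eqP -> /=|/IH]; lia.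
- by rewrite inE => /orP[/eqP -> /=|/IH]; lia.
Qed.

(** Each step raises one coordinate, so the cells of a path form a chain. This lets every cell be
    compared with the one of least distance. *)
Lemma lattice_path_comparable n k s c c' :
  lattice_path n k s -> c \in (n, k) :: s -> c' \in (n, k) :: s ->
  (c.1 <= c'.1)%N && (c.2 <= c'.2)%N || (c'.1 <= c.1)%N && (c'.2 <= c.2)%N.
Proof.
move=> h; elim: h c c' => [|{}n {}k {}s hs IH|{}n {}k {}s hs IH] c c'.
- by rewrite !inE => /eqP -> /eqP ->.
- move=> hc hc'.
  have := hc; rewrite inE => /orP[/eqP -> /=|cs].
    by have := lattice_path_le _ _ _ _ (lattice_pathl _ _ _ hs) hc' => /= ->;
      rewrite orbT.
  have := hc'; rewrite inE => /orP[/eqP -> /=|c's]; last exact: IH.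
  by have := lattice_path_le _ _ _ _ (lattice_pathl _ _ _ hs) hc => /= ->.
- move=> hc hc'.
  have := hc; rewrite inE => /orP[/eqP -> /=|cs].
    by have := lattice_path_le _ _ _ _ (lattice_pathr _ _ _ hs) hc' => /= ->;
      rewrite orbT.
  have := hc'; rewrite inE => /orP[/eqP -> /=|c's]; last exact: IH.
  by have := lattice_path_le _ _ _ _ (lattice_pathr _ _ _ hs) hc => /= ->.
Qed.

(** Charge each cell of the path to the step that leaves it: a step in the first coordinate out of
    [(i, j)] pays for [u i], one in the second pays for [v j]. The end cell [(n, k)] pays for [u n],
    which is why [u] has [n.+1] factors and [v] only [k]. *)
Lemma lattice_path_prod {R : realFieldType} (d : nat * nat -> R) (u v : nat -> R)
    (C : R) n k s :
    0 <= C -> (forall i, 0 <= u i) -> (forall j, 0 <= v j) ->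
    lattice_path n k s ->
    {in (n, k) :: s, forall c, u c.1 <= C * d c /\ v c.2 <= C * d c} ->
  (\prod_(i < n.+1) u i) * (\prod_(j < k) v j) <=
    C ^+ (n + k).+1 * \prod_(c <- (n, k) :: s) d c.
Proof.
move=> C0 u0 v0 hs hd.
have [hu _] := hd _ (mem_head _ _).
suff H : (\prod_(i < n) u i) * (\prod_(j < k) v j) <=
    C ^+ (n + k) * \prod_(c <- s) d c.
  rewrite big_ord_recr big_cons exprS /=.
  have -> : \prod_(i < n) u i * u n * \prod_(j < k) v j =
    (\prod_(i < n) u i * \prod_(j < k) v j) * u n by ring.
  have -> : C * C ^+ (n + k) * (d (n, k) * \prod_(c <- s) d c) =
    (C ^+ (n + k) * \prod_(c <- s) d c) * (C * d (n, k)) by ring.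
  by apply: ler_pM => //; rewrite mulr_ge0 ?prodr_ge0.
elim: hs hd {hu} => {n k s} [_|n k s _ IH hd|n k s _ IH hd].
- by rewrite !big_ord0 big_nil expr0.
- have {}IH := IH (sub_in1 (@mem_behead _ (_ :: _)) hd).
  have [hu _] := hd _ (@mem_behead _ (_ :: _) _ (mem_head _ _)).
  rewrite big_ord_recr big_cons addSn exprS /=.
  have -> : \prod_(i < n) u i * u n * \prod_(j < k) v j =
    (\prod_(i < n) u i * \prod_(j < k) v j) * u n by ring.
  have -> : C * C ^+ (n + k) * (d (n, k) * \prod_(c <- s) d c) =
    (C ^+ (n + k) * \prod_(c <- s) d c) * (C * d (n, k)) by ring.
  by apply: ler_pM => //; rewrite mulr_ge0 ?prodr_ge0.
- have {}IH := IH (sub_in1 (@mem_behead _ (_ :: _)) hd).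
  have [_ hv] := hd _ (@mem_behead _ (_ :: _) _ (mem_head _ _)).
  rewrite big_ord_recr big_cons addnS exprS /=.
  rewrite mulrA.
  have -> : C * C ^+ (n + k) * (d (n, k) * \prod_(c <- s) d c) =
    (C ^+ (n + k) * \prod_(c <- s) d c) * (C * d (n, k)) by ring.
  by apply: ler_pM => //; rewrite mulr_ge0 ?prodr_ge0.
Qed.

End LatticePaths.

(** * Newton interpolation of the reciprocal of a product of linear factors *)

Section Newton.
Context {R : realType}.
Variables al be : nat -> R[i].

(* The divided difference of [1 / \prod_(i < n) ('X - al i)] at the nodes
   [be 0, ..., be k], computed by the Leibniz rule. *)
Fixpoint divdiff (n k : nat) {struct n} : R[i] :=
  if n is n'.+1 then
    (fix row k := if k is k'.+1 then (divdiff n' k - row k') / (be k - al n')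
                  else divdiff n' 0%N / (be 0%N - al n')) k
  else (k == 0%N)%:R.

Lemma divdiff0 k : divdiff 0 k = (k == 0%N)%:R.
Proof. by []. Qed.

Lemma divdiffS0 n : divdiff n.+1 0%N = divdiff n 0%N / (be 0%N - al n).
Proof. by []. Qed.

Lemma divdiffSS n k :
  divdiff n.+1 k.+1 = (divdiff n k.+1 - divdiff n.+1 k) / (be k.+1 - al n).
Proof. by []. Qed.

#[local] Arguments divdiff : simpl never.

(** Induction on [n]: by the recursion of [divdiff], multiplying the Newton sum of level [n.+1] by
    ['X - al n] gives that of level [n] up to a multiple of the nodal polynomial. *)
Lemma newton_interp n K :
    (forall i j, (i < n)%N -> (j < K.+1)%N -> al i != be j) ->
  exists Q : {poly R[i]},
    (\prod_(i < n) ('X - (al i)%:P)) *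
    (\sum_(k < K.+1) divdiff n k *: \prod_(j < k) ('X - (be j)%:P)) =
    1 + Q * \prod_(j < K.+1) ('X - (be j)%:P).
Proof.
elim: n => [_|n IH hne].
  exists 0; rewrite big_ord0 mul1r mul0r addr0 big_ord_recl divdiff0 /= scale1r big_ord0.
  by rewrite big1 ?addr0 // => i _; rewrite divdiff0 scale0r.
have [|Q HQ] := IH; first by move=> i j hi hj; apply: hne => //; lia.
pose P n k : {poly R[i]} :=
  \sum_(j < k) divdiff n j *: \prod_(j0 < j) ('X - (be j0)%:P).
(* The partial sums telescope: write ['X - al n] as [('X - be k) + (be k - al n)] in the term of
   index [k], and only the last nodal product survives. *)
have step k : (k < K.+1)%N -> ('X - (al n)%:P) * P n.+1 k.+1 =
    P n k.+1 + divdiff n.+1 k *: \prod_(j < k.+1) ('X - (be j)%:P).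
  elim: k => [_|k IHk hk].
    rewrite /P !big_ord_recr !big_ord0 /= !add0r mul1r.
    have ne : be 0%N - al n != 0 by rewrite subr_eq0 eq_sym hne.
    have : divdiff n.+1 0%N * (be 0%N - al n) = divdiff n 0%N.
      by rewrite divdiffS0 divfK.
    move: (divdiff n.+1 0%N) (divdiff n 0%N) => w _ <-.
    rewrite -!mul_polyC !mulr1 polyCM polyCB; ring.
  rewrite /P big_ord_recr /= mulrDr -/(P _ k.+1) IHk; last lia.
  rewrite [in RHS]big_ord_recr /= -/(P _ k.+1) -!addrA; congr (_ + _).
  have ne : be k.+1 - al n != 0 by rewrite subr_eq0 eq_sym hne.
  rewrite [\prod_(j < k.+2) _]big_ord_recr /= -!mul_polyC.
  have : divdiff n.+1 k.+1 * (be k.+1 - al n) + divdiff n.+1 k =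
      divdiff n k.+1 by rewrite divdiffSS divfK // subrK.
  move: (divdiff n.+1 k.+1) (divdiff n.+1 k) (divdiff n k.+1) => w w' _ <-.
  rewrite polyCD polyCM polyCB; ring.
exists (Q + \prod_(i < n) ('X - (al i)%:P) * (divdiff n.+1 K)%:P).
rewrite big_ord_recr /= -mulrA (step K) // mulrDr HQ -mul_polyC; ring.
Qed.

(** Instead of summing over all paths, follow at each cell the larger of the two terms of the
    recursion. Each such choice costs a factor 2, and division by [be k - al n] accounts for the
    cell. *)
Lemma divdiff_path n k :
    (forall i j, (i <= n)%N -> (j <= k)%N -> al i != be j) ->
  exists2 s, lattice_path n k s &
    normc (divdiff n.+1 k) *
      (\prod_(c <- (n, k) :: s) normc (al c.1 - be c.2)) <= 2 ^+ (n + k).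
Proof.
pose d c := normc (al c.1 - be c.2).
rewrite -/(d) => hne.
have drop_last n' k' w s : (n' <= n)%N -> (k' <= k)%N ->
    normc (w / (be k' - al n')) * \prod_(c <- (n', k') :: s) d c =
    normc w * \prod_(c <- s) d c.
  move=> hn hk; rewrite big_cons normcM normcV [normc (be _ - _)]normc_distC.
  have d0 : normc (al n' - be k') != 0.
    by rewrite gt_eqF // normc_gt0 // subr_eq0 hne.
  by rewrite -mulrA mulKf.
elim: n k {hne} drop_last => [|n IHn]; elim=> [|k IHk] drop_last.
- exists [::]; first exact: lattice_path0.
  by rewrite divdiffS0 drop_last // divdiff0 normc1 big_nil mul1r.
- have [|s hs le] := IHk; first by move=> *; apply: drop_last => //; lia.
  exists ((0%N, k) :: s); first exact: lattice_pathr.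
  rewrite divdiffSS drop_last //= divdiff0 sub0r normc_opp (le_trans le) //.
  by rewrite ler_weXn2l ?ler1n ?leq_add2l ?leq_add2r //.
- have [|s hs le] := IHn 0%N; first by move=> *; apply: drop_last => //; lia.
  exists ((n, 0%N) :: s); first exact: lattice_pathl.
  rewrite divdiffS0 drop_last //= (le_trans le) //.
  by rewrite ler_weXn2l ?ler1n ?leq_add2l ?leq_add2r //.
- have [|s hs les] := IHn k.+1; first by move=> *; apply: drop_last => //; lia.
  have [|t ht let2] := IHk; first by move=> *; apply: drop_last => //; lia.
  pose x := normc (divdiff n.+1 k.+1); pose y := normc (divdiff n.+2 k).
  pose X := \prod_(c <- (n, k.+1) :: s) d c.
  pose Y := \prod_(c <- (n.+1, k) :: t) d c.
  have X0 : 0 <= X by apply: prodr_ge0 => c _; apply: normc_ge0.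
  have Y0 : 0 <= Y by apply: prodr_ge0 => c _; apply: normc_ge0.
  have xy : normc (divdiff n.+1 k.+1 - divdiff n.+2 k) <= x + y.
    by rewrite (le_trans (normcD_le _ _)) // normc_opp.
  rewrite addSnnS in let2.
  have e : 2 ^+ (n.+1 + k.+1) = 2 ^+ (n + k.+1) + 2 ^+ (n + k.+1) :> R.
    by rewrite addSn exprS; ring.
  have [yx|/ltW xley] := leP y x.
    exists ((n, k.+1) :: s); first exact: lattice_pathl.
    rewrite divdiffSS drop_last // e (le_trans (ler_wpM2r X0 xy)) // mulrDl.
    by rewrite lerD // (le_trans (ler_wpM2r X0 yx)).
  exists ((n.+1, k) :: t); first exact: lattice_pathr.
  rewrite divdiffSS drop_last // e (le_trans (ler_wpM2r Y0 xy)) // mulrDl.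
  by rewrite lerD // (le_trans (ler_wpM2r Y0 xley)).
Qed.

End Newton.

(** * Ordering the zeros by Prim's algorithm *)

Lemma seq_argmin (R : realDomainType) (T : eqType) (f : T -> R) (s : seq T) :
  s != [::] -> exists2 x, x \in s & forall y, y \in s -> f x <= f y.
Proof.
elim: s => // a [|b s] IH _.
  by exists a; rewrite ?mem_head // => y; rewrite inE => /eqP ->.
have [m ms mmin] := IH isT.
have [le|/ltW le] := leP (f a) (f m).
  exists a; rewrite ?mem_head // => y; rewrite inE => /orP[/eqP -> //|ys].
  exact: le_trans le (mmin y ys).
exists m; first by rewrite inE ms orbT.
by move=> y; rewrite inE => /orP[/eqP -> //|]; apply: mmin.
Qed.

Section GreedyOrder.
Context {R : realDomainType} {T : eqType}.
Variables (D : T -> T -> R) (t0 : T).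

(* Prim's rule: each new point is as close to the earlier ones as possible. *)
Definition greedy (n0 : nat) (s : seq T) : Prop :=
  forall l, (n0 <= l < size s)%N -> exists2 a, (a < l)%N &
    forall b m, (b < l)%N -> (l <= m < size s)%N ->
      D (nth t0 s l) (nth t0 s a) <= D (nth t0 s m) (nth t0 s b).

(** Induction on the number of points still to be placed: a closest pair between [r] and [p]
    supplies the next point. *)
Lemma greedy_extension (p r : seq T) :
  p != [::] -> exists2 r', perm_eq r r' & greedy (size p) (p ++ r').
Proof.
have [n] := ubnP (size r); elim: n p r => // n IH p r rn p0.
have [->|r0] := eqVneq r [::].
  by exists [::] => // l; rewrite cats0; lia.
have [|[t u] /allpairsP[[t' u'] /= [tr up [-> ->]]] hmin] :=
    @seq_argmin _ _ (fun tu => D tu.1 tu.2) [seq (t, u) | t <- r, u <- p].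
  by case: (p) (r) p0 r0 => // ? ? [].
have sr := size_rem tr; have r_gt0 : (0 < size r)%N by case: (r) r0.
have [||r' rr' hr'] := IH (rcons p t') (rem t' r).
- by rewrite sr; lia.
- by rewrite -size_eq0 size_rcons.
have rtr : perm_eq r (t' :: r').
  by rewrite (perm_trans (perm_to_rem tr)) // perm_cons.
exists (t' :: r') => //.
rewrite -cat_rcons => l hl.
have [ltl|] := ltnP (size p) l; first by apply: hr'; rewrite size_rcons; lia.
move=> llep; have {llep hl}-> : l = size p by lia.
exists (index u' p); first by rewrite index_mem.
move=> b m hb hm.
rewrite cat_rcons in hm *; rewrite !nth_cat ltnn subnn index_mem up hb /=.
rewrite nth_index // ifN -?leqNgt; last by case/andP: hm.
apply: (hmin (_, _)); apply/allpairsP; eexists (_, _); split=> //=.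
  by rewrite (perm_mem rtr) mem_nth //; rewrite size_cat /= in hm *; lia.
exact: mem_nth.
Qed.

Hypothesis DC : forall x y, D x y = D y x.
Hypothesis Dxx : forall x, D x x = 0.
Hypothesis D_triangle : forall x y z, D x z <= D x y + D y z.

(** If every cut of the order between [i] and [j] is crossed by a pair at distance at most [M], then
    [i] and [j] are joined by links of length at most [M]. The larger index is replaced by its
    nearest predecessor, and the induction is on [i + j], which bounds the number of links. *)
Lemma greedy_chain s M i j : greedy 1 s -> 0 <= M ->
    (i < size s)%N -> (j < size s)%N ->
    (forall l, (minn i j < l <= maxn i j)%N ->
      exists b m, [/\ (b < l)%N, (l <= m < size s)%N &
                      D (nth t0 s m) (nth t0 s b) <= M]) ->
  D (nth t0 s i) (nth t0 s j) <= (i + j)%:R * M.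
Proof.
move=> hs M0; have [n] := ubnP (i + j); elim: n i j => // n IH i j.
wlog ij : i j / (i <= j)%N.
  have [ij h|ji h] := boolP (i <= j)%N; first exact: h.
  move=> hn hi hj hl; rewrite DC addnC; apply: h => //; try lia.
  by rewrite minnC maxnC.
move=> hn hi hj; rewrite (minn_idPl ij) (maxn_idPr ij) => hl.
have [->|neij] := eqVneq i j; first by rewrite Dxx mulr_ge0.
have [a aj ha] := hs j ltac:(lia).
have [b [m [bj mj hM]]] := hl j ltac:(lia).
have jaM := le_trans (ha _ _ bj mj) hM.
have : D (nth t0 s i) (nth t0 s a) <= (i + a)%:R * M.
  apply: IH; try lia; move=> l hl'.
  (* The predecessor [a] may fall below [i]; the new cuts, those between [a] and [i], are crossed by
     the link from [a] to [j]. *)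
  have [li|il] := leqP l i; last by apply: hl; lia.
  by exists a, j; split => //; lia.
move=> iaM; rewrite DC in jaM.
apply: le_trans (D_triangle _ (nth t0 s a) _) _.
apply: le_trans (lerD iaM jaM) _.
by rewrite -[X in _ + X]mul1r -mulrDl natr1 ler_wpM2r // ler_nat; lia.
Qed.

(** The pair [a], [c] itself crosses every cut between them, so [greedy_chain] applies with [M] its
    distance; a sum of two indices is at most [2 * size s]. *)
Lemma greedy_interval s a b c : greedy 1 s -> (a <= b <= c)%N -> (c < size s)%N ->
    0 <= D (nth t0 s a) (nth t0 s c) ->
  D (nth t0 s a) (nth t0 s b) <= (2 * size s)%:R * D (nth t0 s a) (nth t0 s c) /\
  D (nth t0 s b) (nth t0 s c) <= (2 * size s)%:R * D (nth t0 s a) (nth t0 s c).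
Proof.
move=> hs abc cs D0.
have small l : (a < l <= c)%N -> exists b m, [/\ (b < l)%N, (l <= m < size s)%N &
    D (nth t0 s m) (nth t0 s b) <= D (nth t0 s a) (nth t0 s c)].
  by move=> hl; exists a, c; split; rewrite 1?DC //; lia.
split.
  apply: le_trans (greedy_chain s _ _ _ hs D0 _ _ _) _ => //; try lia.
    by move=> l hl; apply: small; lia.
  by rewrite ler_wpM2r // ler_nat; lia.
apply: le_trans (greedy_chain s _ _ _ hs D0 _ _ _) _ => //; try lia.
  by move=> l hl; apply: small; lia.
by rewrite ler_wpM2r // ler_nat; lia.
Qed.

End GreedyOrder.

(** [x] lists [0] and then all the zeros in Prim's order; [p] and [q] give the positions of the two
    families, the first one backwards. *)
Lemma root_order (R : realType) (N K : nat) (als bes : seq R[i]) :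
    size als = N -> size bes = K ->
  exists (x : nat -> R[i]) (p q : nat -> nat),
    [/\ x 0%N = 0,
        (perm_eq als [seq x (p i) | i <- iota 0 N] /\
         perm_eq bes [seq x (q j) | j <- iota 0 K]),
        (forall i j, (i <= j < N)%N -> (p j <= p i <= N + K)%N),
        (forall i j, (i <= j < K)%N -> (q i <= q j <= N + K)%N) &
        forall a b c, (a <= b <= c)%N -> (c <= N + K)%N ->
          normc (x a - x b) <= (2 * (N + K).+1)%:R * normc (x a - x c) /\
          normc (x b - x c) <= (2 * (N + K).+1)%:R * normc (x a - x c)].
Proof.
move=> sN sK.
(* A Boolean tag records the family of each zero, so that equal values stay distinguishable. The
   added [0] has position 0, and the lists [L c] below start at position 1. *)
pose t0 : bool * R[i] := (true, 0).
pose D (t u : bool * R[i]) := normc (t.2 - u.2).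
have [r rE hr] := greedy_extension D t0 [:: t0]
  ([seq (true, z) | z <- als] ++ [seq (false, z) | z <- bes]) isT.
pose X l := nth t0 (t0 :: r) l.
have sr : size r = (N + K)%N.
  by rewrite -(perm_size rE) size_cat !size_map sN sK.
pose L c := [seq l <- iota 1 (N + K) | (X l).1 == c].
have LE c : [seq (X l).2 | l <- L c] = [seq t.2 | t <- r & t.1 == c].
  have -> : r = [seq X l | l <- iota 1 (N + K)].
    by rewrite -sr (iotaDl 1 0) -map_comp; apply: esym (mkseq_nth t0 r).
  by rewrite filter_map -map_comp.
have fst_filter c c' (s : seq R[i]) :
    [seq t.2 | t <- [seq (c', z) | z <- s] & t.1 == c] = if c' == c then s else [::].
  by rewrite filter_map /preim /=; case: ifP => _;
    rewrite ?filter_predT ?filter_pred0 // -map_comp map_id.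
have permL c : perm_eq (if c then als else bes) [seq (X l).2 | l <- L c].
  rewrite LE; apply: perm_trans (perm_map _ (perm_filter _ rE)).
  by rewrite filter_cat map_cat !fst_filter; case: c; rewrite /= ?cats0.
have iotaE (T : Type) (y0 : T) (s : seq T) : [seq nth y0 s i | i <- iota 0 (size s)] = s.
  exact: mkseq_nth.
have szL c : size (L c) = if c then N else K.
  by rewrite -(size_map (fun l => (X l).2)) -(perm_size (permL c)); case: c.
have Lsorted c : sorted leq (L c).
  by apply: sorted_filter (iota_sorted _ _); apply: leq_trans.
have Lle c i : (i < size (L c))%N -> (nth 0%N (L c) i <= N + K)%N.
  by move/(mem_nth 0%N); rewrite mem_filter mem_iota => /and3P[_ _]; rewrite ltnS.
have Lmono c i j : (i <= j)%N -> (j < size (L c))%N ->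
    (nth 0%N (L c) i <= nth 0%N (L c) j)%N.
  move=> ij hj; apply: sorted_leq_nth; rewrite ?inE //; try lia.
  exact: leq_trans.
exists (fun l => (X l).2), (nth 0%N (rev (L true))), (nth 0%N (L false)); split=> //.
- split.
    rewrite (map_comp (fun l => (X l).2)) -[N](szL true) -size_rev iotaE map_rev.
    by rewrite perm_sym perm_rev perm_sym; apply: permL true.
  by rewrite (map_comp (fun l => (X l).2)) -[K](szL false) iotaE; apply: permL false.
- move=> i j hij; have szt := szL true; rewrite /= in szt.
  rewrite !nth_rev ?szt; try lia.
  by rewrite Lmono ?Lle //; lia.
- move=> i j hij; have szt := szL false; rewrite /= in szt.
  by rewrite Lmono ?Lle //; lia.
- move=> a b c abc cNK.
  have -> : (2 * (N + K).+1 = 2 * size (t0 :: r))%N by rewrite /= sr.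
  apply: (greedy_interval D t0) => //=; rewrite ?sr //.
  + by move=> t u; rewrite /D normc_distC.
  + by move=> t; rewrite /D subrr normc0.
  + by move=> t u v; apply: normc_triangle.
  + exact: normc_ge0.
Qed.

(** * Coefficients, linear factors and the Mahler measure *)

Section CoefficientBounds.
Context {R : realType}.
Implicit Types (P : {poly R[i]}) (z : R[i]).

Lemma max1_normc_ge1 z : 1 <= Num.max 1 (normc z).
Proof. by rewrite le_max lexx. Qed.

Lemma max1_normc_ge0 z : 0 <= Num.max 1 (normc z).
Proof. by rewrite le_max ler01. Qed.

(* Synthetic division, from the top coefficient if [normc z <= 1] and from
   the bottom one otherwise. *)
Lemma coef_div_linear P z n (c : R) :
    (size P <= n)%N -> (forall i, normc (P * ('X - z%:P))`_i <= c) ->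
  forall i, normc P`_i * Num.max 1 (normc z) <= n%:R * c.
Proof.
move=> sP hc i.
have c0 : 0 <= c := le_trans (normc_ge0 _) (hc 0%N).
have [ni|i_n] := leqP n i.
  rewrite nth_default; last exact: leq_trans ni.
  by rewrite normc0 mul0r mulr_ge0.
have [z1|/ltW z1] := leP (normc z) 1.
  have H m j : (n <= m + j)%N -> normc P`_j <= m%:R * c.
    elim: m j => [|m IH] j nmj.
      by rewrite nth_default ?normc0 ?mul0r //; apply: leq_trans sP _.
    have -> : P`_j = (P * ('X - z%:P))`_j.+1 + P`_j.+1 * z.
      by rewrite mulrBr coefB coefMX coefMC /= subrK.
    rewrite (le_trans (normcD_le _ _)) // -nat1r mulrDl mul1r lerD // normcM.
    rewrite (le_trans _ (IH j.+1 _)) //; last lia.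
    by rewrite ler_piMr // normc_ge0.
  by rewrite mulr1 H // leq_addr.
have H j : normc P`_j * normc z <= j.+1%:R * c.
  elim: j => [|j IH].
    rewrite -normcM -normc_opp mul1r.
    have -> : - (P`_0 * z) = (P * ('X - z%:P))`_0.
      by rewrite mulrBr coefB coefMX coefMC sub0r.
    exact: hc.
  have -> : normc P`_j.+1 * normc z = normc (P`_j - (P * ('X - z%:P))`_j.+1).
    by rewrite -normcM mulrBr coefB coefMX coefMC /= opprB addrC subrK.
  rewrite (le_trans (normcD_le _ _)) // normc_opp -[j.+2%:R]natr1 mulrDl mul1r.
  by rewrite lerD // (le_trans _ IH) // ler_peMr // normc_ge0.
by rewrite (le_trans (H i)) // ler_wpM2r // ler_nat.
Qed.

(** Remove the linear factors one by one with [coef_div_linear]: each division gains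
    [Num.max 1 (normc z)] and costs the current degree, whence the factorial. *)
Lemma mahler_le (zs : seq R[i]) b (c : R) :
    (forall i, normc (b *: \prod_(z <- zs) ('X - z%:P))`_i <= c) ->
  normc b * \prod_(z <- zs) Num.max 1 (normc z) <= (size zs)`!%:R * c.
Proof.
elim: zs c => [|z zs IH] c hc.
  by have := hc 0%N; rewrite !big_nil fact0 alg_polyC coefC mulr1 mul1r.
pose m : R := Num.max 1 (normc z).
have m0 : 0 < m := lt_le_trans ltr01 (max1_normc_ge1 z).
have H : normc b * \prod_(z <- zs) Num.max 1 (normc z) <=
    (size zs)`!%:R * ((size zs).+1%:R * c / m).
  apply: IH => i; rewrite ler_pdivlMr //.
  apply: coef_div_linear => [|j].
    by rewrite (leq_trans (size_scale_leq _ _)) // size_prod_XsubC.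
  by have := hc j; rewrite big_cons mulrC scalerAl.
rewrite big_cons -/m factS natrM.
have -> : normc b * (m * \prod_(z <- zs) Num.max 1 (normc z)) =
  (normc b * \prod_(z <- zs) Num.max 1 (normc z)) * m by ring.
apply: le_trans (ler_wpM2r (ltW m0) H) _.
suff -> : (size zs)`!%:R * ((size zs).+1%:R * c / m) * m =
  (size zs).+1%:R * (size zs)`!%:R * c by [].
by field; rewrite gt_eqF.
Qed.

Lemma coef_prod_linear_le (x : nat -> R[i]) k i :
  normc (\prod_(j < k) ('X - (x j)%:P))`_i <=
  2 ^+ k * \prod_(j < k) Num.max 1 (normc (x j)).
Proof.
elim: k i => [|k IH] i.
  rewrite !big_ord0 mulr1 expr0 coef1.
  by case: (i == 0)%N; rewrite ?normc1 ?normc0.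
rewrite !big_ord_recr /= mulrBr coefB coefMX coefMC.
set X := \prod_(j < k) Num.max _ _ in IH *.
set m : R := Num.max 1 (normc (x k)).
have m1 : 1 <= m := max1_normc_ge1 _.
have xm : normc (x k) <= m by rewrite le_max lexx orbT.
have X0 : 0 <= 2 ^+ k * X.
  by rewrite mulr_ge0 ?exprn_ge0 ?prodr_ge0 // => *; apply: max1_normc_ge0.
rewrite exprS; have -> : 2 * 2 ^+ k * (X * m) = 2 ^+ k * X * m + 2 ^+ k * X * m.
  ring.
rewrite (le_trans (normcD_le _ _)) // normc_opp normcM lerD //.
  apply: (@le_trans _ _ (2 ^+ k * X)); last by rewrite ler_peMr.
  by case: (i == 0)%N; rewrite ?normc0.
by apply: ler_pM => //; apply: normc_ge0.
Qed.

End CoefficientBounds.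

(** * Comparing path products with a row and a column *)

Section KeyEstimate.
Context {R : realType}.
Variables (N K : nat) (x : nat -> R[i]) (p q : nat -> nat) (c : R).
Hypothesis c1 : 1 <= c.
Hypothesis x0 : x 0%N = 0.
Hypothesis p_anti : forall i j, (i <= j < N)%N -> (p j <= p i <= N + K)%N.
Hypothesis q_mono : forall i j, (i <= j < K)%N -> (q i <= q j <= N + K)%N.
Hypothesis x_interval : forall l m n, (l <= m <= n)%N -> (n <= N + K)%N ->
  normc (x l - x m) <= c * normc (x l - x n) /\
  normc (x m - x n) <= c * normc (x l - x n).

Let al i := x (p i).
Let be j := x (q j).
Let d i j := normc (al i - be j).
Let M j : R := Num.max 1 (normc (be j)).

(** Because the order begins with [0], moduli are distances to the first point and grow along the
    order up to the factor [c]. *)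
Lemma normc_order_le l m : (l <= m <= N + K)%N -> normc (x l) <= c * normc (x m).
Proof.
move=> lm; have [||h _] := x_interval 0%N l m; try lia.
by move: h; rewrite x0 !sub0r !normc_opp.
Qed.

Lemma max1_normc_be_le j k : (j <= k < K)%N -> M j <= c * M k.
Proof.
move=> jk; rewrite ge_max; apply/andP; split.
  rewrite -[1]mulr1; apply: ler_pM => //; exact: max1_normc_ge1.
apply: le_trans (normc_order_le (q j) (q k) (q_mono _ _ jk)) _.
by rewrite ler_wpM2l ?(le_trans ler01 c1) // le_max lexx orbT.
Qed.

(* The next two lemmas are where the opposite orders of the [al] and the [be]
   matter: the cell of least distance controls every comparable cell. *)
Lemma dist_row_le i j i0 j0 :
    (i < N)%N -> (j < K)%N -> (i0 < N)%N -> (j0 < K)%N ->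
    (i <= i0)%N && (j <= j0)%N || (i0 <= i)%N && (j0 <= j)%N ->
    d i0 j0 <= d i j ->
  d i j0 <= c * d i j.
Proof.
move=> iN jK i0N j0K cmp dmin.
have dmin' : c * d i0 j0 <= c * d i j by rewrite ler_wpM2l ?(le_trans ler01 c1).
have pi : (p i <= N + K)%N by have := p_anti i i; lia.
have pi0 : (p i0 <= N + K)%N by have := p_anti i0 i0; lia.
have qj : (q j <= N + K)%N by have := q_mono j j; lia.
have qj0 : (q j0 <= N + K)%N by have := q_mono j0 j0; lia.
case/orP: cmp => /andP[ii jj].
  have pii : (p i0 <= p i)%N by have := p_anti i i0; lia.
  have qjj : (q j <= q j0)%N by have := q_mono j j0; lia.
  (* Either [q j0] lies between [q j] and [p i], and the distance is compared with [d i j], or [p i]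
     lies between [p i0] and [q j0], and it is compared with the least distance [d i0 j0]. *)
  have [qp|/ltnW pq] := leqP (q j0) (p i).
    have [||_ h] := x_interval (q j) (q j0) (p i); try lia.
    by rewrite /d normc_distC [X in _ <= _ * X]normc_distC.
  have [||_ h] := x_interval (p i0) (p i) (q j0); try lia.
  exact: le_trans h dmin'.
have pii : (p i <= p i0)%N by have := p_anti i0 i; lia.
have qjj : (q j0 <= q j)%N by have := q_mono j0 j; lia.
have [pq|/ltnW qp] := leqP (p i) (q j0).
  by have [||h _] := x_interval (p i) (q j0) (q j); try lia.
have [||h _] := x_interval (q j0) (p i) (p i0); try lia.
apply: le_trans dmin'; rewrite /d normc_distC; apply: le_trans h _.
by rewrite normc_distC.
Qed.

Lemma dist_col_le i j i0 j0 :
    (i < N)%N -> (j < K)%N -> (i0 < N)%N -> (j0 < K)%N ->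
    (i <= i0)%N && (j <= j0)%N || (i0 <= i)%N && (j0 <= j)%N ->
    d i0 j0 <= d i j ->
  d i0 j <= c * d i j.
Proof.
move=> iN jK i0N j0K cmp dmin.
have dmin' : c * d i0 j0 <= c * d i j by rewrite ler_wpM2l ?(le_trans ler01 c1).
have pi : (p i <= N + K)%N by have := p_anti i i; lia.
have pi0 : (p i0 <= N + K)%N by have := p_anti i0 i0; lia.
have qj : (q j <= N + K)%N by have := q_mono j j; lia.
have qj0 : (q j0 <= N + K)%N by have := q_mono j0 j0; lia.
case/orP: cmp => /andP[ii jj].
  have pii : (p i0 <= p i)%N by have := p_anti i i0; lia.
  have qjj : (q j <= q j0)%N by have := q_mono j j0; lia.
  have [qp|/ltnW pq] := leqP (q j) (p i0).
    have [||h _] := x_interval (q j) (p i0) (p i); try lia.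
    by rewrite /d normc_distC [X in _ <= _ * X]normc_distC.
  have [||h _] := x_interval (p i0) (q j) (q j0); try lia.
  exact: le_trans h dmin'.
have pii : (p i <= p i0)%N by have := p_anti i0 i; lia.
have qjj : (q j0 <= q j)%N by have := q_mono j0 j; lia.
have [pq|/ltnW qp] := leqP (p i0) (q j).
  by have [||_ h] := x_interval (p i) (p i0) (q j); try lia.
have [||_ h] := x_interval (q j0) (q j) (p i0); try lia.
apply: le_trans dmin'; rewrite /d normc_distC; apply: le_trans h _.
by rewrite normc_distC.
Qed.

Variables (a b : R[i]) (delta C : R).
Hypothesis delta0 : 0 < delta.
Hypothesis row_ge : forall j, (j < K)%N -> delta <= normc a * \prod_(i < N) d i j.
Hypothesis col_ge : forall i, (i < N)%N -> delta <= normc b * \prod_(j < K) d i j.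

(** If the first zero of all is some [be], then [normc (al i - be 0)] is at most
    [(1 + c) * normc (al i)] for all [i], so row 0 is bounded in terms of the constant coefficient
    of the first polynomial. Otherwise the same holds for column [N.-1], the earliest [al]. *)
Lemma delta_le : (0 < N)%N -> (0 < K)%N ->
    normc a * \prod_(i < N) normc (al i) <= 1 ->
    normc b * \prod_(j < K) normc (be j) <= 1 ->
  delta <= (1 + c) ^+ (N + K).
Proof.
move=> N0 K0 ha hb.
have c_ge1 : 1 <= 1 + c by rewrite lerDl (le_trans ler01 c1).
have c_ge0 : 0 <= 1 + c := le_trans ler01 c_ge1.
have [qp|/ltnW pq] := leqP (q 0%N) (p N.-1).
  apply: le_trans (row_ge _ K0) _.
  have : \prod_(i < N) d i 0%N <= \prod_(i < N) ((1 + c) * normc (al i)).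
    apply: ler_prod => i _; rewrite normc_ge0 /= /d mulrDl mul1r.
    rewrite (le_trans (normcD_le _ _)) // normc_opp lerD // normc_order_le //.
    by have := ltn_ord i; have := p_anti i N.-1; have := p_anti i i; lia.
  rewrite big_split /= prodr_const card_ord => h.
  apply: le_trans (ler_wpM2l (normc_ge0 _) h) _.
  rewrite mulrCA (le_trans (ler_wpM2l (exprn_ge0 _ c_ge0) ha)) // mulr1.
  by rewrite ler_weXn2l // leq_addr.
have N1 : (N.-1 < N)%N by lia.
apply: le_trans (col_ge _ N1) _.
have : \prod_(j < K) d N.-1 j <= \prod_(j < K) ((1 + c) * normc (be j)).
  apply: ler_prod => j _; rewrite normc_ge0 /= /d mulrDl mul1r.
  rewrite (le_trans (normcD_le _ _)) // normc_opp addrC lerD // normc_order_le //.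
  by have := ltn_ord j; have := q_mono 0%N j; have := q_mono j j; lia.
rewrite big_split /= prodr_const card_ord => h.
apply: le_trans (ler_wpM2l (normc_ge0 _) h) _.
rewrite mulrCA (le_trans (ler_wpM2l (exprn_ge0 _ c_ge0) hb)) // mulr1.
by rewrite ler_weXn2l // leq_addl.
Qed.

(** A lower bound for the path product, with the weights [M j] that will absorb the Newton basis
    polynomials. [C2] stands for the Mahler bound and [C3] for the bound on [delta]. *)
Lemma path_estimate n k s (C2 C3 : R) :
    N = n.+1 -> (k < K)%N -> lattice_path n k s ->
    normc b * \prod_(j < K) M j <= C2 -> delta <= C3 ->
  delta ^+ 2 * \prod_(j < k) M j <=
    (c ^+ 2 + c + 1) ^+ (N + K) * (C2 + C3) * normc a *
    \prod_(e <- (n, k) :: s) d e.1 e.2.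
Proof.
move=> Nn kK hs hC2 hC3.
have c0 : 0 <= c := le_trans ler01 c1.
have cc : c <= c ^+ 2 by rewrite expr2 ler_peMl.
have cC : c <= c ^+ 2 + c + 1 by have := sqr_ge0 c; lra.
have C1 : 1 <= c ^+ 2 + c + 1 by lra.
have M0 j : 0 <= M j := max1_normc_ge0 _.
have d0 i j : 0 <= d i j := normc_ge0 _.
have a0 : 0 <= normc a := normc_ge0 _.
have b0 : 0 <= normc b := normc_ge0 _.
have C2_ge0 : 0 <= C2.
  by apply: le_trans hC2; rewrite mulr_ge0 // prodr_ge0.
have C3_ge0 : 0 <= C3 by apply: le_trans hC3; apply: ltW.
have path_in e : e \in (n, k) :: s -> (e.1 < N)%N /\ (e.2 <= k)%N.
  by move/(lattice_path_le _ _ _ _ hs)/andP => [e1 e2]; rewrite Nn.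
pose X := \prod_(e <- (n, k) :: s) d e.1 e.2.
have X0 : 0 <= X by apply: prodr_ge0.
have pow_le m : (m <= N + K)%N -> (c ^+ 2 + c + 1) ^+ m <= (c ^+ 2 + c + 1) ^+ (N + K).
  by move=> mle; rewrite ler_weXn2l.
have [[i0 j0] e0s dmin] :=
  @seq_argmin _ _ (fun e => d e.1 e.2) ((n, k) :: s) isT.
have [/= i0N j0k] := path_in _ e0s.
have j0K : (j0 < K)%N by apply: leq_ltn_trans j0k kK.
(* If the least distance exceeds [M k], then row [k] alone is enough, and the
   other steps of the path are paid for by the factors [M j]. *)
have [mu_le|mu_gt] := leP (d i0 j0) (M k).
  have row e : e \in (n, k) :: s -> d e.1 j0 <= (c ^+ 2 + c + 1) * d e.1 e.2.
    move=> es; have [e1 e2] := path_in _ es.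
    apply: (@le_trans _ _ (c * d e.1 e.2)); last by rewrite ler_wpM2r.
    apply: (dist_row_le _ _ i0) => //; [exact: leq_ltn_trans e2 kK | | exact: dmin].
    exact: (lattice_path_comparable _ _ _ _ (i0, j0) hs es e0s).
  have col e : e \in (n, k) :: s -> d i0 e.2 <= (c ^+ 2 + c + 1) * d e.1 e.2.
    move=> es; have [e1 e2] := path_in _ es.
    apply: (@le_trans _ _ (c * d e.1 e.2)); last by rewrite ler_wpM2r.
    apply: (dist_col_le _ _ _ j0) => //; [exact: leq_ltn_trans e2 kK | | exact: dmin].
    exact: (lattice_path_comparable _ _ _ _ (i0, j0) hs es e0s).
  have := lattice_path_prod (fun e => d e.1 e.2) (fun i => d i j0) (d i0)
    (c ^+ 2 + c + 1) n k s (le_trans ler01 C1) (fun _ => d0 _ _) (d0 _) hs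
    (fun e es => conj (row e es) (col e es)).
  rewrite -/X -addSn -Nn => hX.
  (* The path reaches only the first [k] factors of column [i0]. For [j >= k], the distance is at
     most [d i0 j0 + normc (be j0) + normc (be j)], and these terms are at most [c], [c ^+ 2] and 1
     times [M j]; hence the constant. *)
  have tail : \prod_(k <= j < K) d i0 j <=
      (c ^+ 2 + c + 1) ^+ (K - k) * \prod_(k <= j < K) M j.
    have -> : (c ^+ 2 + c + 1) ^+ (K - k) = \prod_(k <= j < K) (c ^+ 2 + c + 1).
      by rewrite prodr_const_nat.
    rewrite -big_split /= !big_nat; apply: ler_prod => j /andP[kj jK].
    rewrite d0 /=.
    have Mkj : M k <= c * M j by apply: max1_normc_be_le; rewrite kj.
    have Mj0k : M j0 <= c * M k by apply: max1_normc_be_le; rewrite j0k.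
    have bM l : normc (be l) <= M l by rewrite le_max lexx orbT.
    have h1 : d i0 j <= d i0 j0 + normc (be j0) + normc (be j).
      rewrite /d (le_trans (normc_triangle _ (be j0) _)) // -addrA lerD2l.
      by rewrite (le_trans (normcD_le _ _)) // normc_opp.
    have h2 : c * M k <= c * (c * M j) by rewrite ler_wpM2l.
    have h3 := bM j0; have h4 := bM j.
    have -> : (c ^+ 2 + c + 1) * M j = c * (c * M j) + c * M j + M j by ring.
    lra.
  have split_K (f : nat -> R) :
      \prod_(j < K) f j = \prod_(j < k) f j * \prod_(k <= j < K) f j.
    by rewrite -!(big_mkord xpredT) -big_cat_nat //= ltnW.
  have hrow := row_ge _ j0K; have hcol := col_ge _ i0N.
  rewrite split_K in hcol; rewrite split_K in hC2.
  set U := \prod_(i < N) d i j0 in hX hrow.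
  set V := \prod_(j < k) d i0 j in hX hcol.
  set V' := \prod_(k <= j < K) d i0 j in tail hcol.
  set W := \prod_(j < k) M j in hC2 *.
  set W' := \prod_(k <= j < K) M j in tail hC2.
  have W0 : 0 <= W by apply: prodr_ge0.
  have V'0 : 0 <= V' by apply: prodr_ge0.
  have W'0 : 0 <= W' by apply: prodr_ge0.
  have U0 : 0 <= U by apply: prodr_ge0.
  have V0 : 0 <= V by apply: prodr_ge0.
  have P0 m : 0 <= (c ^+ 2 + c + 1) ^+ m by rewrite exprn_ge0 // (le_trans ler01 C1).
  (* Row [U] and full column [V * V'] give one factor [delta] each; afterwards [W * W'] is the whole
     product of the [M j], bounded through [C2]. *)
  apply: (@le_trans _ _ (normc a * normc b * ((U * V) * V') * W)).
    apply: ler_wpM2r => //; rewrite expr2.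
    have -> : normc a * normc b * (U * V * V') =
      (normc a * U) * (normc b * (V * V')) by ring.
    by apply: ler_pM => //; apply: ltW.
  apply: (@le_trans _ _ (normc a * normc b *
      (((c ^+ 2 + c + 1) ^+ (N + k) * X) * ((c ^+ 2 + c + 1) ^+ (K - k) * W')) * W)).
    apply: ler_wpM2r => //; apply: ler_wpM2l; first by rewrite mulr_ge0.
    by apply: ler_pM => //; rewrite mulr_ge0.
  have -> : (c ^+ 2 + c + 1) ^+ (N + K) =
      (c ^+ 2 + c + 1) ^+ (N + k) * (c ^+ 2 + c + 1) ^+ (K - k).
    by rewrite -exprD; rewrite -addnA subnKC // ltnW.
  set p1 := _ ^+ (N + k); set p2 := _ ^+ (K - k).
  have -> : normc a * normc b * (p1 * X * (p2 * W')) * W =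
    (p1 * p2 * normc a * X) * (normc b * (W * W')) by ring.
  have -> : p1 * p2 * (C2 + C3) * normc a * X =
    (p1 * p2 * normc a * X) * (C2 + C3) by ring.
  apply: ler_wpM2l; first by rewrite !mulr_ge0 // P0.
  by rewrite (le_trans hC2) // lerDl.
have hX : (\prod_(i < n.+1) d i k) * (\prod_(j < k) M j) <=
    (c ^+ 2 + c + 1) ^+ (N + K) * X.
  have H e : e \in (n, k) :: s -> d e.1 k <= (c ^+ 2 + c + 1) * d e.1 e.2 /\
      M e.2 <= (c ^+ 2 + c + 1) * d e.1 e.2.
    move=> es; have [e1 e2] := path_in _ es.
    have Me2 : M e.2 <= c * M k by apply: max1_normc_be_le; rewrite e2.
    have dM : M k <= d e.1 e.2 by apply: le_trans (ltW mu_gt) (dmin _ es).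
    have h1 : c * M k <= c * d e.1 e.2 by rewrite ler_wpM2l.
    have h2 : c * d e.1 e.2 <= c ^+ 2 * d e.1 e.2 by rewrite ler_wpM2r.
    have h0 : d e.1 e.2 <= c * d e.1 e.2 by rewrite ler_peMl.
    have bM l : normc (be l) <= M l by rewrite le_max lexx orbT.
    have h3 := bM k; have h4 := bM e.2.
    have h5 : d e.1 k <= d e.1 e.2 + normc (be e.2) + normc (be k).
      rewrite /d (le_trans (normc_triangle _ (be e.2) _)) // -addrA lerD2l.
      by rewrite (le_trans (normcD_le _ _)) // normc_opp.
    have d0' := d0 e.1 e.2.
    by rewrite !mulrDl mul1r; split; lra.
  have := lattice_path_prod (fun e => d e.1 e.2) (fun i => d i k) M
    (c ^+ 2 + c + 1) n k s (le_trans ler01 C1) (fun _ => d0 _ _) M0 hs H.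
  rewrite -/X -addSn -Nn => hX; apply: le_trans hX _.
  by rewrite ler_wpM2r // pow_le // leq_add2l ltnW.
rewrite -Nn in hX.
have hrow := row_ge _ kK; rewrite -/X.
have W0 : 0 <= \prod_(j < k) M j by apply: prodr_ge0.
have -> : (c ^+ 2 + c + 1) ^+ (N + K) * (C2 + C3) * normc a * X =
  (C2 + C3) * (normc a * ((c ^+ 2 + c + 1) ^+ (N + K) * X)) by ring.
(* Row [k] uses only one factor [delta]; the other is bounded by the constant [C3]. *)
rewrite expr2 -mulrA; apply: ler_pM; rewrite ?mulr_ge0 ?(ltW delta0) //.
  by rewrite (le_trans hC3) // lerDr.
apply: le_trans (ler_wpM2r W0 hrow) _.
by rewrite -mulrA ler_wpM2l.
Qed.

End KeyEstimate.

(** * The bound for one cofactor *)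

Lemma bezout_coefficient_bound (R : realType) (N K : nat) :
    (0 < N)%N -> (0 < K)%N ->
  exists2 C : R, 0 < C & forall (A B : {poly R[i]}) (delta : R),
    size A = N.+1 -> size B = K.+1 ->
    (forall i, normc A`_i <= 1) -> (forall i, normc B`_i <= 1) -> 0 < delta ->
    (forall z, B.[z] = 0 -> delta <= normc A.[z]) ->
    (forall z, A.[z] = 0 -> delta <= normc B.[z]) ->
  exists P Q : {poly R[i]}, [/\ A * P + B * Q = 1, (size P <= K)%N &
    forall i, normc P`_i <= C / delta ^+ 2].
Proof.
move=> N0 K0.
pose c : R := (2 * (N + K).+1)%:R.
have c1 : 1 <= c by rewrite /c -[1]/(1%:R) ler_nat.
(* The constant of [path_estimate], with [C2] from [mahler_le] and [C3] from [delta_le]. *)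
pose D := (c ^+ 2 + c + 1) ^+ (N + K) * (K`!%:R + (1 + c) ^+ (N + K)).
have c0 : 0 < c := lt_le_trans ltr01 c1.
have D0 : 0 < D.
  by rewrite mulr_gt0 ?exprn_gt0 ?addr_gt0 ?exprn_gt0 ?ltr0n ?fact_gt0 ?addr_gt0.
(* [K] is the number of Newton terms, [2 ^+ (N + K)] comes from [divdiff_path], and [2 ^+ K] from
   the coefficients of the Newton basis. *)
exists (K%:R * (2 ^+ (N + K) * 2 ^+ K * D)).
  by rewrite mulr_gt0 ?ltr0n // mulr_gt0 // mulr_gt0 // exprn_gt0.
move=> A B delta sA sB A1 B1 delta0 hA hB.
have [als Aals] := closed_field_poly_normal A.
have [bes Bbes] := closed_field_poly_normal B.
set a := lead_coef A in Aals; set b := lead_coef B in Bbes.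
have a0 : a != 0 by rewrite lead_coef_eq0 -size_poly_eq0 sA.
have b0 : b != 0 by rewrite lead_coef_eq0 -size_poly_eq0 sB.
have sals : size als = N.
  by move: sA; rewrite Aals size_scale // size_prod_XsubC => -[].
have sbes : size bes = K.
  by move: sB; rewrite Bbes size_scale // size_prod_XsubC => -[].
have B_mahler : normc b * \prod_(z <- bes) Num.max 1 (normc z) <= K`!%:R.
  by rewrite -sbes -[X in _ <= X]mulr1 mahler_le // -Bbes.
have [x [p [q [x0 [pa pb] panti qmono xint]]]] := root_order _ _ _ _ _ sals sbes.
pose al i := x (p i); pose be j := x (q j).
pose d i j := normc (al i - be j).
have prod_iota (T : Type) (idx : T) (op : Monoid.com_law idx) n (f : nat -> T) :
    \big[op/idx]_(i <- iota 0 n) f i = \big[op/idx]_(i < n) f i.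
  by rewrite -(big_mkord xpredT) /index_iota subn0.
have AE : A = a *: \prod_(i < N) ('X - (al i)%:P).
  by rewrite Aals (perm_big _ pa) big_map prod_iota.
have BE : B = b *: \prod_(j < K) ('X - (be j)%:P).
  by rewrite Bbes (perm_big _ pb) big_map prod_iota.
rewrite (perm_big _ pb) big_map prod_iota in B_mahler.
have horner_norm w n (f : nat -> R[i]) z :
    normc (w *: \prod_(i < n) ('X - (f i)%:P)).[z] =
    normc w * \prod_(i < n) normc (z - f i).
  rewrite hornerZ horner_prod normcM normc_prod; congr (_ * _).
  by apply: eq_bigr => i _; rewrite !hornerE.
have B_root j : (j < K)%N -> B.[be j] = 0.
  move=> jK; apply: eq0_normc; rewrite BE horner_norm.
  by rewrite (bigD1 (Ordinal jK)) //= subrr normc0 mul0r mulr0.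
have A_root i : (i < N)%N -> A.[al i] = 0.
  move=> iN; apply: eq0_normc; rewrite AE horner_norm.
  by rewrite (bigD1 (Ordinal iN)) //= subrr normc0 mul0r mulr0.
have row_ge j : (j < K)%N -> delta <= normc a * \prod_(i < N) d i j.
  move=> jK; have := hA _ (B_root _ jK); rewrite AE horner_norm.
  by under eq_bigr do rewrite normc_distC.
have col_ge i : (i < N)%N -> delta <= normc b * \prod_(j < K) d i j.
  by move=> iN; have := hB _ (A_root _ iN); rewrite BE horner_norm.
have A_at0 : normc a * \prod_(i < N) normc (al i) <= 1.
  have := A1 0%N; rewrite -horner_coef0 AE horner_norm.
  by under eq_bigr do rewrite sub0r normc_opp.
have B_at0 : normc b * \prod_(j < K) normc (be j) <= 1.
  have := B1 0%N; rewrite -horner_coef0 BE horner_norm.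
  by under eq_bigr do rewrite sub0r normc_opp.
have delta_ub := delta_le N K x p q c c1 x0 panti qmono xint a b delta delta0
  row_ge col_ge N0 K0 A_at0 B_at0.
have al_be i j : (i < N)%N -> (j < K)%N -> al i != be j.
  move=> iN jK; apply: contraTneq delta0 => e; rewrite -leNgt.
  by rewrite (le_trans (hA _ (B_root _ jK))) // -e A_root // normc0.
have NS : N.-1.+1 = N by rewrite prednK.
pose M j : R := Num.max 1 (normc (be j)).
have dd_le k : (k < K)%N ->
    normc (divdiff al be N k) * (2 ^+ k * \prod_(j < k) M j) <=
    2 ^+ (N + K) * 2 ^+ K * D * normc a / delta ^+ 2.
  move=> kK; have [|s hs dd_s] := divdiff_path al be N.-1 k.
    move=> i j iN jk; apply: al_be; last exact: leq_ltn_trans jk kK.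
    by rewrite -NS ltnS.
  have est := path_estimate N K x p q c c1 x0 panti qmono xint a b delta delta0
    row_ge col_ge N.-1 k s _ _ (esym NS) kK hs B_mahler delta_ub.
  rewrite NS in dd_s.
  have w0 : 0 <= normc (divdiff al be N k) := normc_ge0 _.
  have aD0 : 0 <= D * normc a by rewrite mulr_ge0 ?normc_ge0 // ltW.
  move: dd_s est; set w := normc (divdiff _ _ _ _) in w0 *.
  set X := \prod_(e <- _) _; set W := \prod_(j < k) _ => dd_s est.
  have {}est : delta ^+ 2 * W <= D * normc a * X by [].
  rewrite ler_pdivlMr ?exprn_gt0 //.
  have -> : w * (2 ^+ k * W) * delta ^+ 2 = 2 ^+ k * (w * (delta ^+ 2 * W)) by ring.
  have -> : 2 ^+ (N + K) * 2 ^+ K * D * normc a =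
    2 ^+ K * (2 ^+ (N + K) * (D * normc a)) by ring.
  have pow2 m l : (m <= l)%N -> 2 ^+ m <= 2 ^+ l :> R.
    by move=> ml; rewrite ler_weXn2l ?ler1n.
  have W0 : 0 <= W by apply: prodr_ge0 => j _; apply: max1_normc_ge0.
  apply: ler_pM; rewrite ?exprn_ge0 ?pow2 ?(ltnW kK) //.
    by rewrite mulr_ge0 // mulr_ge0 // exprn_ge0 // ltW.
  apply: le_trans (ler_wpM2l w0 est) _.
  rewrite mulrCA mulrC; apply: ler_wpM2r => //.
  apply: le_trans dd_s _; apply: pow2.
  by apply: leq_add (leq_pred _) (ltnW kK).
have [K' KS] : exists K', K = K'.+1 by exists K.-1; rewrite prednK.
have [Q HQ] := newton_interp al be N K' (fun i j => fun iN jK =>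
  al_be i j iN (etrans (congr1 _ KS) jK)).
rewrite -KS in HQ.
set S := \sum_(k < K) _ in HQ.
(* The interpolation identity concerns the monic parts of [A] and [B], so the leading coefficients
   are divided out. The factor [normc a] in [dd_le] cancels the [a^-1] introduced here. *)
exists (a^-1 *: S), (- (b^-1 *: Q)); split.
- rewrite AE BE -scalerAl -scalerAr scalerA divff // scale1r HQ.
  by rewrite mulrN -scalerAl -scalerAr scalerA divff // scale1r [Q * _]mulrC addrK.
- apply: leq_trans (size_scale_leq _ _) _; apply: leq_trans (size_sum _ _ _) _.
  apply/bigmax_leqP => k _; apply: leq_trans (size_scale_leq _ _) _.
  by rewrite size_prod_XsubC /index_enum -enumT size_enum_ord.
move=> i; rewrite coefZ normcM normcV mulrC ler_pdivrMr ?normc_gt0 // coef_sum.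
have normc_sum n (f : 'I_n -> R[i]) :
    normc (\sum_(k < n) f k) <= \sum_(k < n) normc (f k).
  elim/big_rec2: _ => [|k y1 y2 _ h]; first by rewrite normc0.
  by rewrite (le_trans (normcD_le _ _)) // lerD2l.
apply: le_trans (normc_sum _ _) _.
apply: (@le_trans _ _ (\sum_(k < K) 2 ^+ (N + K) * 2 ^+ K * D * normc a / delta ^+ 2)).
  apply: ler_sum => k _; rewrite coefZ normcM.
  apply: le_trans (dd_le _ (ltn_ord k)); apply: ler_wpM2l; first exact: normc_ge0.
  exact: coef_prod_linear_le.
rewrite sumr_const card_ord -mulr_natl le_eqVlt; apply/orP; left; apply/eqP.
by field; rewrite gt_eqF.
Qed.

(** * Polynomial identities, uniqueness and degrees of the minimal solutions *)

(** The difference [r] vanishes everywhere, so [r + 1] has no zero and is constant, the field being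
    algebraically closed. *)
Lemma horner_eq_poly (F : closedFieldType) (p q : {poly F}) :
  (forall z, p.[z] = q.[z]) -> p = q.
Proof.
move=> pq; apply/eqP; rewrite -subr_eq0; set r := p - q.
have r0 z : r.[z] = 0 by rewrite hornerD hornerN pq subrr.
have /eqP s1 : size (r + 1) == 1%N.
  apply: contraT => /closed_rootP[z /rootP]; rewrite hornerD r0 hornerC add0r.
  by move/eqP; rewrite oner_eq0.
have [d _ rd] := size_poly1P _ (introT eqP s1).
have re : r = (d - 1)%:P by rewrite polyCB -rd addrK.
by have := r0 0; rewrite re hornerC => ->.
Qed.

Lemma coef_norm_le (R : realType) (P : {poly R[i]}) (c : R) :
  0 <= c -> (forall i, normc P`_i <= c) -> coef_norm P <= c.
Proof. by move=> c0 h; apply: bigmax_le. Qed.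

Lemma coef_le_coef_norm (R : realType) (P : {poly R[i]}) i :
  normc P`_i <= coef_norm P.
Proof.
have [Pi|iP] := leqP (size P) i.
  rewrite nth_default // normc0 /coef_norm.
  by elim/big_rec: _ => // j y _ y0; rewrite le_max y0 orbT.
exact: (le_bigmax _ (fun j : 'I_(size P) => normc P`_j) (Ordinal iP)).
Qed.

Lemma minimal_solution_poly (R : realType) N K (A B P Q : {poly R[i]}) :
  minimal_solution N K A B P Q <->
  [/\ (size P <= K)%N, (size Q <= N)%N & A * P + B * Q = 1].
Proof.
split=> -[sP sQ h]; split=> //.
  by apply: horner_eq_poly => z; rewrite hornerD !hornerM h hornerC.
by move=> z; rewrite -!hornerM -hornerD h hornerC.
Qed.

(** [B] is coprime to [A] and divides [A * (P - P')], hence divides [P - P'], whose degree is too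
    small unless it is zero. *)
Lemma bezout_unique (F : fieldType) N K (A B P Q P' Q' : {poly F}) :
    (N < size A)%N -> (K < size B)%N ->
    A * P + B * Q = 1 -> A * P' + B * Q' = 1 ->
    (size P <= K)%N -> (size P' <= K)%N ->
  P = P' /\ Q = Q'.
Proof.
move=> sA sB h h' sP sP'.
have B0 : B != 0 by rewrite -size_poly_gt0 (leq_ltn_trans _ sB).
have AB : coprimep B A.
  apply/Bezout_eq1_coprimepP; exists (Q, P) => /=.
  by rewrite -h mulrC [P * A]mulrC addrC.
have e : A * (P - P') = B * (Q' - Q).
  apply/eqP; rewrite -subr_eq0.
  have -> : A * (P - P') - B * (Q' - Q) = (A * P + B * Q) - (A * P' + B * Q').
    by ring.
  by rewrite h h' subrr.
have PP : P = P'.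
  apply/eqP; rewrite -subr_eq0; apply: contraT => PP'.
  have : B %| P - P' by rewrite -(Gauss_dvdpr _ AB) e dvdp_mulr.
  move/(dvdp_leq PP'); rewrite leqNgt => /negP[].
  apply: leq_ltn_trans sB; apply: leq_trans (size_polyD _ _) _.
  by rewrite size_polyN geq_max sP sP'.
split=> //; apply: (mulfI B0); apply: (addrI (A * P)).
by rewrite h {1}PP h'.
Qed.

(** Compare degrees in [B * Q = 1 - A * P]; [0 < N] ensures that the constant 1 does not exceed the
    size bound [N + K]. *)
Lemma size_bezout_cofactor (F : fieldType) N K (A B P Q : {poly F}) :
    (0 < N)%N -> size A = N.+1 -> size B = K.+1 ->
    A * P + B * Q = 1 -> (size P <= K)%N ->
  (size Q <= N)%N.
Proof.
move=> N0 sA sB h sP.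
have [->|Q0] := eqVneq Q 0; first by rewrite size_poly0.
have B0 : B != 0 by rewrite -size_poly_eq0 sB.
have : (size (B * Q)%R <= maxn 1 (N + K))%N.
  have -> : B * Q = 1 - A * P by rewrite -h addrC addKr.
  apply: leq_trans (size_polyD _ _) _; rewrite size_polyN size_poly1.
  rewrite geq_max leq_maxl /=; apply: leq_trans (size_polyMleq _ _) _.
  by rewrite sA addSn /= leq_max leq_add2l sP orbT.
by rewrite size_mul // sB addSn /=; move: (size Q) => m; lia.
Qed.

(** * Both cofactors together *)

Lemma delta_lbound (R : realType) (A B : {poly R[i]}) z :
    A.[z] = 0 \/ B.[z] = 0 -> (1 < size A)%N -> (1 < size B)%N ->
  delta A B <= normc A.[z] + normc B.[z].
Proof.
by move=> hz sA sB; apply: (delta_min sA sB).2; exists z.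
Qed.

Theorem theorem2p10 (R : realType) (N K : nat) (hN : (1 <= N)%N) (hK : (1 <= K)%N) :
  exists C : R, 0 < C /\
    forall A B : {poly R[i]},
      size A = N.+1 -> size B = K.+1 ->
      coef_norm A <= 1 -> coef_norm B <= 1 ->
      0 < delta A B ->
      (exists! PQ : {poly R[i]} * {poly R[i]},
         minimal_solution N K A B PQ.1 PQ.2) /\
      (forall P Q : {poly R[i]},
         minimal_solution N K A B P Q ->
         coef_norm P <= C / delta A B ^+ 2 /\
         coef_norm Q <= C / delta A B ^+ 2).
Proof.
have [C1 C1_gt0 h1] := bezout_coefficient_bound R N K hN hK.
have [C2 C2_gt0 h2] := bezout_coefficient_bound R K N hK hN.
exists (C1 + C2); split=> [|A B sA sB A1 B1 delta0]; first exact: addr_gt0.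
have A1' i := le_trans (coef_le_coef_norm R A i) A1.
have B1' i := le_trans (coef_le_coef_norm R B i) B1.
have lbA z : B.[z] = 0 -> delta A B <= normc A.[z].
  move=> Bz; have := delta_lbound R A B z (or_intror Bz).
  by rewrite Bz normc0 addr0 sA sB; apply; rewrite ltnS.
have lbB z : A.[z] = 0 -> delta A B <= normc B.[z].
  move=> Az; have := delta_lbound R A B z (or_introl Az).
  by rewrite Az normc0 add0r sA sB; apply; rewrite ltnS.
have [P [Q [PQ sP bP]]] := h1 A B _ sA sB A1' B1' delta0 lbA lbB.
(* With [A] and [B] exchanged, the bounded cofactor is that of [B]; by uniqueness it is the [Q]
   found above, so one pair satisfies both bounds. *)
have [Q' [P' [QP' sQ' bQ']]] := h2 B A _ sB sA B1' A1' delta0 lbB lbA.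
have sQ := size_bezout_cofactor _ N K A B P Q hN sA sB PQ sP.
have uniq U V : minimal_solution N K A B U V -> P = U /\ Q = V.
  move/minimal_solution_poly => [sU _ UV].
  by apply: (bezout_unique _ N K A B) => //; rewrite ?sA ?sB.
have [_ QQ'] : P' = P /\ Q' = Q.
  apply/and_comm; apply: (bezout_unique _ K N B A) => //; rewrite ?sA ?sB //.
  by rewrite addrC.
have le_C (c : R) : 0 < c -> c <= C1 + C2 ->
    0 <= c / delta A B ^+ 2 /\ c / delta A B ^+ 2 <= (C1 + C2) / delta A B ^+ 2.
  move=> c0 cC; have d2 : 0 <= (delta A B ^+ 2)^-1 by rewrite invr_ge0 sqr_ge0.
  by split; [rewrite mulr_ge0 // ltW | apply: ler_wpM2r].
split.
  exists (P, Q); split=> [|[U V] /uniq[-> ->] //].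
  by apply/minimal_solution_poly.
move=> U V /uniq[<- <-]; split.
  have [|c0 cC] := le_C C1 C1_gt0; first by rewrite lerDl ltW.
  exact: le_trans (coef_norm_le _ _ _ c0 bP) cC.
have [|c0 cC] := le_C C2 C2_gt0; first by rewrite lerDr ltW.
by rewrite -QQ'; apply: le_trans (coef_norm_le _ _ _ c0 bQ') cC.
Qed.
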